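(* Let $F$ be a field with a non-trivial involution $c$, let $V$ be a finite-dimensional vector space over $F$ of dimension at least $2$, and let $T:V\to V$ be an invertible linear map. Then $V$ admits a $T$-invariant non-degenerate $c$-hermitian form if and only if every elementary divisor of $T$ is either self-dual, or its dual is also an elementary divisor of $T$ with the same multiplicity.
   Context: An involution on a field $F$ is an automorphism $c:\alpha\mapsto\alpha^c$ of $F$ with $(\alpha^c)^c=\alpha$ for all $\alpha$; it is non-trivial if it is not the identity. A $c$-sesquilinear form on $V$ is a bi-additive map $\sigma:V\times V\to F$ with $\sigma(\alpha v,\beta w)=\alpha\beta^c\sigma(v,w)$; it is $c$-hermitian if moreover $\sigma(v,w)=\sigma(w,v)^c$ for all $v,w$. It is $T$-invariant if $\sigma(Tv,Tw)=\sigma(v,w)$ for all $v,w$. Elementary divisors: $V$ is a direct sum of $T$-indecomposable subspaces $V_i$, each $(V_i,T|_{V_i})$ being isomorphic to $F[x]/(p(x)^k)$ with multiplication by $x$, where $p(x)$ is a monic irreducible factor of the minimal polynomial of $T$. Each such $p(x)^k$ is an elementary divisor of $T$, and the number of times it occurs in the decomposition is its multiplicity. Duality: for a monic polynomial $f(x)=\sum_{i=0}^d a_ix^i$ over $F$ ($a_d=1$) not having $0$, $1$ or $-1$ as a root, the dual is $f^*(x)=(f(0)^c)^{-1}x^d f^c(x^{-1})=\frac{1}{a_0^c}\sum_{i=0}^d a_{d-i}^c x^i$, where $f^c(x)=\sum a_i^c x^i$. A polynomial $f$ is called self-dual if it is either a power of $x-1$ or of $x+1$, or if it is monic, does not have $0$,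 $1$ or $-1$ as a root, and satisfies $f=f^*$. *)

(* Defs.v *)
From mathcomp Require Import all_boot all_order all_algebra.

Set Implicit Arguments.
Unset Strict Implicit.
Unset Printing Implicit Defensive.

Import GRing.Theory.
Local Open Scope ring_scope.

Section ElementaryDivisors.
Variables (F : fieldType) (V : vectType F) (T : 'End(V)).
Implicit Types (U : {vspace V}) (f : {poly F}) (s : seq {poly F}).

Definition stable U : bool := (T @: U <= U)%VS.

Definition indecomposable U : Prop :=
  [/\ U != 0%VS, stable U
    & forall U1 U2 : {vspace V}, stable U1 -> stable U2 ->
        (U1 + U2)%VS = U -> (U1 :&: U2)%VS = 0%VS ->
        U1 = 0%VS \/ U2 = 0%VS].

(* (U, T restricted to U) is isomorphic to F[x]/(f) with multiplication by x.
   {poly %/ f} is the intended quotient only for f monic and non-constant,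
   which holds for the prime powers used below. *)
Definition iso_quotient U f : Prop :=
  exists phi : 'Hom({poly %/ f}, V),
    [/\ lker phi = 0%VS, limg phi = U
      & forall q : {poly %/ f}, phi ('qX * q) = T (phi q)].

(* That p divides the minimal polynomial of T is automatic when
   iso_quotient U (p ^+ k) holds with k > 0. *)
Definition primary_piece U f : Prop :=
  exists (p : {poly F}) (k : nat),
    [/\ p \is monic, irreducible_poly p, (0 < k)%N, f = p ^+ k
      & iso_quotient U f].

(* s lists, with repetitions and in some order, the elementary divisors given
   by a decomposition of V into indecomposable subspaces; by Krull-Schmidt two
   such lists differ only by a permutation. *)
Definition elementary_divisors s : Prop :=
  exists U_ : 'I_(size s) -> {vspace V},
    [/\ (\sum_i U_ i)%VS = fullv, directv (\sum_i U_ i)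
      & forall i, indecomposable (U_ i) /\ primary_piece (U_ i) s`_i].

Definition elementary_divisor f : Prop :=
  exists2 s, elementary_divisors s & f \in s.

Definition has_multiplicity f (m : nat) : Prop :=
  exists2 s, elementary_divisors s & count_mem f s = m.

End ElementaryDivisors.

Section Duality.
Variables (F : fieldType) (c : {rmorphism F -> F}).
Implicit Types f : {poly F}.

Definition dualizable f : bool :=
  [&& f \is monic, ~~ root f 0, ~~ root f 1 & ~~ root f (-1)].

(* Only meaningful when dualizable f. *)
Definition dual f : {poly F} :=
  (c f.[0])^-1 *: \poly_(i < size f) c f`_((size f).-1 - i).

Definition self_dual f : Prop :=
  [\/ exists k : nat, f = ('X - 1) ^+ k,
      exists k : nat, f = ('X + 1) ^+ k
    | dualizable f /\ f = dual f].

End Duality.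

Definition T_invariant (F : fieldType) (V : vectType F) (T : 'End(V))
    (sigma : V -> V -> F) : Prop :=
  forall v w, sigma (T v) (T w) = sigma v w.

(* Main.v *)
(* If sigma is a T-invariant form, the adjoint of q(T) is q^c(T^-1), which is
   T^-n times the reversed conjugate of q at T.  Nondegeneracy makes the kernel
   of an operator and of its adjoint equidimensional, so dim ker q(T) =
   dim ker q*(T), and these dimensions determine the multiplicities.

   Conversely, split V into cyclic pieces F[x]/(p^k).  A linear functional lam
   on F[x]/(f) that does not vanish at p^(k-1) gives a perfect T-invariant
   sesquilinear pairing B(u, r) = lam (r^c(T^-1) u) between F[x]/(f) and the
   cyclic piece of the dual f*.  If f <> f*, this makes the sum of the two
   pieces a hyperbolic space.  If f = f*, the form b B(u, w) + (b B(w, u))^c is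
   hermitian; its radical is a submodule, hence contains the socle if it is
   nonzero, and this cannot happen for both b = 1 and a scalar b not fixed
   by c. *)

Require Import Defs.
From mathcomp Require Import all_boot all_order all_algebra.
From HB Require Import structures.
From Stdlib Require Import Classical.
From mathcomp Require Import zify ring.

Set Implicit Arguments.
Unset Strict Implicit.
Unset Printing Implicit Defensive.

Import GRing.Theory.
Local Open Scope ring_scope.

(** * The action of F[x] on V through T, and cyclic submodules *)

Section PolynomialAction.
Variables (F : fieldType) (V : vectType F).
Implicit Types (T : 'End(V)) (U W : {vspace V}) (p q f g e r : {poly F}) (u v w : V).

(** The operator q(T). Powers of T are iterated compositions, so no ring structure on ['End(V)] is
    needed. *)
Definition act T q : 'End(V) :=
  \sum_(i < size q) q`_i *: iter i (comp_lfun T) \1%VF.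

Lemma actE T q n v : (size q <= n)%N ->
  act T q v = \sum_(i < n) q`_i *: iter i T v.
Proof.
move=> le_qn; rewrite sum_lfunE.
have itE i : iter i (comp_lfun T) \1%VF v = iter i T v.
  by elim: i => [|i IH] /=; rewrite ?id_lfunE // comp_lfunE IH.
under eq_bigr => i _ do rewrite scale_lfunE itE.
rewrite (big_ord_widen n (fun i => q`_i *: iter i T v)) // big_mkcond /=.
apply: eq_bigr => i _; case: ltnP => // le_qi.
by rewrite nth_default ?scale0r.
Qed.

Lemma actD T p q v : act T (p + q) v = act T p v + act T q v.
Proof.
pose n := maxn (size p) (size q).
rewrite (actE T (n := n)) ?size_polyD // (actE T _ (q := p) (n := n)) ?leq_maxl //.
rewrite (actE T _ (q := q) (n := n)) ?leq_maxr // -big_split /=.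
by apply: eq_bigr => i _; rewrite coefD scalerDl.
Qed.

Lemma actZ T a p v : act T (a *: p) v = a *: act T p v.
Proof.
rewrite (actE T (n := size p)) ?size_scale_leq // (actE T _ (leqnn (size p))).
by rewrite scaler_sumr; apply: eq_bigr => i _; rewrite coefZ scalerA.
Qed.

Lemma actC T a v : act T a%:P v = a *: v.
Proof.
by rewrite (actE T (n := 1)) ?size_polyC ?leq_b1 // big_ord1 coefC.
Qed.

Lemma act0 T v : act T 0 v = 0.
Proof. by rewrite actC scale0r. Qed.

Lemma act1 T v : act T 1 v = v.
Proof. by rewrite actC scale1r. Qed.

Lemma actMX T q v : act T (q * 'X) v = T (act T q v).
Proof.
rewrite (actE T (n := (size q).+1)) ?(leq_trans (size_polyMleq _ _)) //; last first.
  by rewrite size_polyX addn2.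
rewrite (actE T _ (leqnn (size q))) linear_sum big_ord_recl coefMX scale0r add0r.
by apply: eq_bigr => i _; rewrite coefMX linearZ.
Qed.

Lemma actM T p q v : act T (p * q) v = act T p (act T q v).
Proof.
elim/poly_ind: p => [|p a IH]; first by rewrite mul0r !act0.
rewrite mulrDl !actD mulrAC !actMX mul_polyC actZ actC.
by rewrite IH.
Qed.

Lemma actX T v : act T 'X v = T v.
Proof. by rewrite -['X]mul1r actMX act1. Qed.

Lemma actN T p v : act T (- p) v = - act T p v.
Proof. by rewrite -scaleN1r actZ scaleN1r. Qed.

Lemma actXn T n v : act T 'X^n v = iter n T v.
Proof. by elim: n => [|n IH]; rewrite ?act1 // exprSr actMX IH. Qed.

Lemma actCA T p q v : act T p (act T q v) = act T q (act T p v).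
Proof. by rewrite -!actM mulrC. Qed.

Lemma act_dvd T f q v : act T f v = 0 -> f %| q -> act T q v = 0.
Proof.
by move=> fv0 /dvdpP[h ->]; rewrite actM fv0 linear0.
Qed.

Lemma stable_act T U q u : stable T U -> u \in U -> act T q u \in U.
Proof.
move=> /subvP sU Uu; elim/poly_ind: q => [|q a IH]; first by rewrite act0 mem0v.
rewrite actD actMX actC memvD ?memvZ //.
by apply: sU; apply: memv_img.
Qed.

Lemma stableP T U : (forall u, u \in U -> T u \in U) -> stable T U.
Proof. by move=> H; apply/subvP=> _ /memv_imgP[u Uu ->]; apply: H. Qed.

Lemma stableD T U W : stable T U -> stable T W -> stable T (U + W).
Proof. by move=> sU sW; rewrite /stable limgD addvS. Qed.

Lemma stable0 T : stable T 0.
Proof. by rewrite /stable limg0. Qed.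

Lemma stable_cap_ker T U q : stable T U -> stable T (U :&: lker (act T q)).
Proof.
move=> sU; apply: stableP => u /memv_capP[Uu]; rewrite memv_ker => /eqP qu0.
rewrite memv_cap memv_ker -{1}actX stable_act //=.
by rewrite -(actX T u) actCA qu0 linear0.
Qed.

Lemma bezout_act T p q v : coprimep p q ->
  exists a b, act T a (act T p v) + act T b (act T q v) = v.
Proof.
move=> /Bezout_eq1_coprimepP[[a b] /= e].
by exists a, b; rewrite -!actM -actD e act1.
Qed.

(* [U] is the cyclic F[T]-module generated by [v], with annihilator [(f)]. *)
Definition cyclic_on T U v f : Prop :=
  [/\ f != 0, forall u, u \in U <-> exists q, u = act T q v
    & forall q, act T q v = 0 <-> f %| q].

(** Polynomials of size at most [n] form a space of dimension [n], so this linear map turns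
    submodule dimensions into degrees. The factor [e] selects the submodule generated by
    [act T e v]. *)
Definition poly_orbit T e v n (r : {poly_n F}) : V := act T (e * (r : {poly F})) v.

Fact poly_orbit_linear T e v n : linear (@poly_orbit T e v n).
Proof.
move=> a p q; rewrite /poly_orbit /= -actZ -actD; congr (act T _ v).
by rewrite mulrDr scalerAr.
Qed.

HB.instance Definition _ T e v n :=
  GRing.isLinear.Build F {poly_n F} V _ (@poly_orbit T e v n)
    (@poly_orbit_linear T e v n).

Lemma dim_poly_orbit T e v n U :
  (forall r, (size r <= n)%N -> act T (e * r) v = 0 -> r = 0) ->
  (forall u, u \in U <-> exists2 r : {poly F}, (size r <= n)%N & u = act T (e * r) v) ->
  \dim U = n.
Proof.
move=> inj imU; pose phi := linfun (@poly_orbit T e v n).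
have -> : U = limg phi.
  apply/vspaceP => u; apply/idP/memv_imgP => [/imU[r sr ->]|[r _ ->]].
    by exists (npolyp n r); rewrite ?memvf // lfunE /= /poly_orbit npolypK.
  by apply/imU; exists (r : {poly F}); rewrite ?lfunE //; apply: size_npoly.
rewrite limg_dim_eq ?dim_polyn //; apply/eqP; rewrite -subv0.
apply/subvP => r /memv_capP[_]; rewrite memv_ker lfunE /= memv0 => /eqP r0.
by apply/eqP/val_inj/inj => //=; apply: size_npoly.
Qed.

Lemma cyclic_stable T U v f : cyclic_on T U v f -> stable T U.
Proof.
case=> _ mU _; apply: stableP => _ /mU[q ->]; apply/mU.
by exists (q * 'X); rewrite actMX.
Qed.

Lemma cyclic_gen T U v f : cyclic_on T U v f -> v \in U.
Proof. by case=> _ mU _; apply/mU; exists 1; rewrite act1. Qed.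

Lemma cyclic_ann T U v f u : cyclic_on T U v f -> u \in U -> act T f u = 0.
Proof. by case=> _ mU aU /mU[q ->]; rewrite actCA (aU f).2 ?linear0. Qed.

Lemma cyclic_mod T U v f q : cyclic_on T U v f -> act T q v = act T (q %% f) v.
Proof.
case=> _ _ aU; rewrite [in LHS](divp_eq q f) actD actM.
by rewrite (aU f).2 // linear0 add0r.
Qed.

(** With h = gcd(f, g) and e = f / h, the vector q(T)v is killed by g(T) iff f divides gq, iff e
    divides q. The kernel is thus generated by e(T)v, whose annihilator is (h), and has dimension
    deg h. *)
Lemma dim_cyclic_ker T U v f g : cyclic_on T U v f ->
  \dim (U :&: lker (act T g)) = (size (gcdp f g)).-1.
Proof.
move=> cU; have [f0 mU aU] := cU; set h := gcdp f g; set e := f %/ h.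
have h0 : h != 0 by rewrite gcdp_eq0 (negPf f0).
have fE : f = h * e by rewrite mulrC divpK ?dvdp_gcdl.
have gE : g = g %/ h * h by rewrite divpK ?dvdp_gcdr.
have e0 : e != 0 by apply: contra_neq f0 => e0; rewrite fE e0 mulr0.
have sh (r : {poly F}) : (size r <= (size h).-1)%N = (size r < size h)%N.
  by have := h0; rewrite -size_poly_gt0; case: (size h).
apply: (@dim_poly_orbit T e v) => [r | u].
  rewrite sh => ltrh /aU; rewrite [X in X %| _]fE mulrC dvdp_mul2l // => /eqP.
  by rewrite modp_small.
split=> [|[r _ ->]].
  case/memv_capP => /mU[q ->]; rewrite memv_ker -actM => /eqP/aU.
  rewrite [X in X %| _]fE gE mulrAC mulrC dvdp_mul2r //.
  rewrite Gauss_dvdpr ?coprimep_div_gcd ?f0 //.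
  case/dvdpP => r qE; exists (r %% h); first by rewrite sh ltn_modpN0.
  rewrite qE [in LHS](divp_eq r h) mulrDl actD [r %% h * e]mulrC.
  by rewrite -mulrA -[h * e]fE actM (aU f).2 // linear0 add0r.
rewrite memv_cap memv_ker; apply/andP; split; first by apply/mU; exists (e * r).
apply/eqP; rewrite -actM; apply/aU; rewrite gE -mulrA [h * _]mulrA -fE.
by rewrite mulrCA dvdp_mulr.
Qed.

Lemma dim_cyclic T U v f : cyclic_on T U v f -> \dim U = (size f).-1.
Proof.
move=> cU; have := dim_cyclic_ker f cU.
rewrite gcdpp => <-; congr (\dim _); apply/esym/capv_idPl.
by apply/subvP => u Uu; rewrite memv_ker (cyclic_ann cU).
Qed.
End PolynomialAction.

(** * Cyclic modules with prime-power annihilator and their socles *)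

Section PrimaryCyclic.
Variables (F : fieldType) (V : vectType F) (T : 'End(V)).
Implicit Types (U W : {vspace V}) (p q f g h r : {poly F}) (u v w : V).

(** The generator is the image of 1; conversely q is sent to q(T)v. The hypotheses on [f] ensure
    [mk_monic f = f], so that [{poly %/ f}] really is the quotient by [f]. *)
Lemma iso_quotient_cyclic U f : f \is monic -> (1 < size f)%N ->
  iso_quotient T U f <-> exists v, cyclic_on T U v f.
Proof.
move=> mf sf; have mkf : mk_monic f = f by rewrite /mk_monic sf mf.
have modE q : Pdiv.CommonRing.rmodp q (mk_monic f) = q %% f.
  by rewrite mkf -Pdiv.IdomainMonic.modpE.
split=> [[phi [kphi imphi phiX]]|[v cU]].
  have actphi q : act T q (phi 1) = phi (in_qpoly f q).
    elim/poly_ind: q => [|q a IH]; first by rewrite act0 rmorph0 linear0.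
    rewrite actD actMX actC IH -phiX rmorphD rmorphM linearD [in_qpoly f 'X * _]mulrC.
    congr (phi _ + _); rewrite -linearZ; congr (phi _).
    by rewrite -(rmorph1 (in_qpoly f)) -linearZ /= alg_polyC.
  exists (phi 1); split; first exact: monic_neq0.
    rewrite -imphi => u; split=> [/memv_imgP[q _ ->]|[q ->]].
      exists (q : {poly F}); rewrite actphi; congr (phi _); apply/val_inj => /=.
      exact/esym/in_qpoly_small/size_mk_monic.
    by rewrite actphi memv_img ?memvf.
  move=> q; rewrite actphi.
  have {}injphi : injective phi by apply/lker0P; rewrite kphi.
  split=> [e|fq].
    have /(congr1 val) /= : in_qpoly f q = 0 by apply: injphi; rewrite e linear0.
    by rewrite modE => /eqP.
  rewrite -[RHS](linear0 phi); congr (phi _); apply/val_inj => /=.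
  by rewrite modE; apply/eqP.
have [f0 mU aU] := cU.
pose phi := linfun (@poly_orbit F V T 1 v (size (mk_monic f)).-1).
have phiE (q : {poly %/ f}) : phi q = act T (q : {poly F}) v.
  by rewrite lfunE /= /poly_orbit mul1r.
exists phi; split.
- apply/eqP; rewrite -subv0; apply/subvP => q; rewrite memv_ker phiE memv0.
  move=> /eqP/aU fq; apply/eqP/val_inj => /=; rewrite -(modp_small (p := q) (q := f)).
    by apply/eqP.
  by apply: leq_trans (size_mk_monic q) _; rewrite mkf.
- apply/vspaceP => u; apply/memv_imgP/idP => [[q _ ->]|/mU[q ->]].
    by rewrite phiE; apply/mU; exists (q : {poly F}).
  exists (in_qpoly f q); rewrite ?memvf // phiE /= modE.
  exact: cyclic_mod cU.
- move=> q; rewrite !phiE -actMX [RHS](cyclic_mod _ cU) /=.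
  by rewrite !modE mulrC modp_mul.
Qed.

Definition primary_cyclic U f : Prop :=
  exists v p k, [/\ p \is monic, irreducible_poly p, (0 < k)%N, f = p ^+ k
    & cyclic_on T U v f].

Lemma irreducible_size p : irreducible_poly p -> (0 < (size p).-1)%N.
Proof. by case; case: (size p) => [|[]]. Qed.

Lemma size_irr_pow_gt1 p k : irreducible_poly p -> (0 < k)%N -> (1 < size (p ^+ k))%N.
Proof.
move=> ip k0; have : (0 < (size (p ^+ k)).-1)%N.
  by rewrite size_exp muln_gt0 irreducible_size.
by case: (size _) => [|[]].
Qed.

(** Strong induction on the size: either a smaller non-constant divisor exists, or [g] itself, made
    monic, is irreducible. *)
Lemma irreducible_factor g : (1 < size g)%N ->
  exists p, [/\ p \is monic, irreducible_poly p & p %| g].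
Proof.
have [n] := ubnP (size g); elim: n g => // n IH g ltgn sg.
have [[h [h1 hg ltgh]]|noh] :=
    classic (exists h, [/\ size h != 1, h %| g & (size h < size g)%N]).
  have g0 : g != 0 by rewrite -size_poly_gt0 ltnW.
  have h0 : h != 0 by apply: contraTneq hg => ->; rewrite dvd0p.
  have [||p [mp ip ph]] := IH h.
  - by apply: leq_trans ltgh _.
  - by rewrite ltn_neqAle eq_sym h1 size_poly_gt0.
  by exists p; split=> //; apply: dvdp_trans ph hg.
have g0 : g != 0 by rewrite -size_poly_gt0 ltnW.
have lg0 : (lead_coef g)^-1 != 0 by rewrite invr_eq0 lead_coef_eq0.
exists ((lead_coef g)^-1 *: g); split; last by rewrite dvdpZl.
  by rewrite monicE lead_coefZ mulVf ?lead_coef_eq0.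
split=> [|h h1]; first by rewrite size_scale.
rewrite dvdpZr // => hg; rewrite -dvdp_size_eqp ?dvdpZr // size_scale //.
rewrite eqn_leq dvdp_leq //= leqNgt; apply/negP => lt_hg.
by apply: noh; exists h.
Qed.

Lemma irreducible_multiplicity p q : irreducible_poly p -> q != 0 ->
  exists j h, q = h * p ^+ j /\ coprimep h p.
Proof.
move=> ip; have [n] := ubnP (size q); elim: n q => // n IH q leqn q0.
have [pq|npq] := boolP (p %| q); last first.
  by exists 0, q; rewrite mulr1 coprimep_sym irreducible_poly_coprime.
have [h qE] := dvdpP _ _ pq.
have h0 : h != 0 by apply: contra_neq q0; rewrite qE => ->; rewrite mul0r.
have [||j [h' [hE cop]]] := IH h; rewrite ?h0 //.
  rewrite -ltnS; apply: leq_trans leqn; rewrite ltnS qE size_mul ?(irredp_neq0 ip) //.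
  by case: (size p) (irreducible_size ip) => [|[|m]] //= _; rewrite !addnS ltnS leq_addr.
by exists j.+1, h'; rewrite qE hE exprSr mulrA.
Qed.

(* The element [act (p ^+ k.-1) v] generates the smallest nonzero stable subspace. *)
Lemma cyclic_socle U v p k u : irreducible_poly p -> (0 < k)%N ->
  cyclic_on T U v (p ^+ k) -> u \in U -> u != 0 ->
  exists g, act T g u = act T (p ^+ k.-1) v.
Proof.
move=> ip k0 cU Uu u0; have [_ mU aU] := cU; have [q uE] := (mU u).1 Uu.
have q0 : q != 0 by apply: contra_neq u0; rewrite uE => ->; rewrite act0.
have [j [h [qE cop]]] := irreducible_multiplicity ip q0.
have ltjk : (j < k)%N.
  rewrite ltnNge; apply: contra u0 => lekj; rewrite uE; apply/eqP/aU.
  by rewrite qE dvdp_mull // dvdp_exp2l.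
(* With u = h p^j v and j < k, the factor p^(k-1-j) raises p^j to p^(k-1). On the resulting vector
   p^k acts as zero, so by Bezout [a] inverts h there. *)
have [a [b /esym e]] := bezout_act T (act T (p ^+ k.-1) v) (coprimep_expr k cop).
exists (a * p ^+ (k.-1 - j)).
have z : act T (p ^+ k) (act T (p ^+ k.-1) v) = 0.
  by rewrite actCA (aU _).2 ?dvdpp // linear0.
rewrite uE qE [in RHS]e z linear0 addr0.
rewrite -!actM; congr (act T _ v).
rewrite -[k.-1 in RHS](@subnK j); last by rewrite -ltnS prednK.
by rewrite exprD; ring.
Qed.

Lemma cyclic_socle_neq0 U v p k : irreducible_poly p -> (0 < k)%N ->
  cyclic_on T U v (p ^+ k) -> act T (p ^+ k.-1) v != 0.
Proof.
move=> ip k0 [_ _ aU]; apply/eqP => /aU; rewrite dvdp_Pexp2l.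
  by rewrite -ltnS prednK // ltnn.
by have := irreducible_size ip; case: (size p) => [|[]].
Qed.

Lemma exists_functional v : v != 0 ->
  exists lam : 'Hom(V, F^o), lam v != 0.
Proof.
move=> v0; have [i ci|c0] := pickP (fun i => coord (vbasis {:V}) i v != 0).
  by exists (linfun (coord (vbasis {:V}) i : V -> F^o)); rewrite lfunE.
case/eqP: v0; rewrite (coord_vbasis (memvf v)) big1 // => i _.
by have /eqP-> := negbFE (c0 i); rewrite scale0r.
Qed.

Lemma limg_stable U : stable T U -> lker T == 0%VS -> (T @: U)%VS = U.
Proof.
move=> sU /eqP k0; apply/eqP; rewrite eqEdim -/(stable T U) sU limg_dim_eq /= ?leqnn //.
by rewrite k0 capv0.
Qed.

End PrimaryCyclic.

(** * Decomposition of V into indecomposable cyclic pieces *)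

Section Decomposition.
Variables (F : fieldType) (V : vectType F) (T : 'End(V)).
Implicit Types (U W : {vspace V}) (p q f g h r : {poly F}) (u v w : V).
Implicit Types (s : seq {poly F}) (P : {vspace V} -> {poly F} -> Prop).

Lemma indecomposable_split U U1 U2 : indecomposable T U ->
  stable T U1 -> stable T U2 -> (U1 + U2)%VS = U -> (U1 :&: U2)%VS = 0%VS ->
  U1 = U \/ U2 = U.
Proof.
case=> _ _ H s1 s2 eU e0; case: (H U1 U2 s1 s2 eU e0) => z.
  by right; rewrite -eU z add0v.
by left; rewrite -eU z addv0.
Qed.

(** Bezout writes u = a f u + b g u, where g kills the first term and f the second. *)
Lemma ker_coprime_split U f g : stable T U -> coprimep f g ->
  (U <= lker (act T (f * g)))%VS ->
  (U :&: lker (act T f) + U :&: lker (act T g))%VS = U /\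
  (U :&: lker (act T f) :&: (U :&: lker (act T g)))%VS = 0%VS.
Proof.
move=> sU cop ann; split.
  apply/eqP; rewrite eqEsubv subv_add !capvSl /=; apply/subvP => u Uu.
  have := subvP ann _ Uu; rewrite memv_ker actM => /eqP fg0.
  have [a [b <-]] := bezout_act T u cop.
  rewrite addrC; apply: memv_add; rewrite memv_cap memv_ker.
    by rewrite !stable_act //= actCA fg0 linear0.
  by rewrite !stable_act //= actCA [act T g _]actCA fg0 linear0.
apply/eqP; rewrite -subv0; apply/subvP => u.
rewrite !memv_cap !memv_ker => /andP[/andP[_ /eqP f0] /andP[_ /eqP g0]].
have [a [b <-]] := bezout_act T u cop.
by rewrite f0 g0 !linear0 addr0 mem0v.
Qed.

(** Polynomials of size at most [(dim V).+1] form a space larger than V, so evaluation at [v] has a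
    nonzero kernel. *)
Lemma exists_vector_annihilator v : exists2 g, g != 0 & act T g v = 0.
Proof.
pose phi := linfun (@poly_orbit F V T 1 v (dim V).+1).
have [r] : exists2 r, r \in lker phi & r != 0.
  exists (vpick (lker phi)); first exact: memv_pick.
  rewrite vpick0 -dimv_eq0; have := limg_ker_dim phi fullv.
  rewrite capfv dim_polyn; have := dimvS (subvf (limg phi)); rewrite dimvf; lia.
rewrite memv_ker lfunE /= /poly_orbit mul1r => /eqP r0 nr0.
by exists (r : {poly F}).
Qed.

Lemma exists_annihilator : exists2 g, g != 0 & forall v, act T g v = 0.
Proof.
have [g g0 ann] : exists2 g, g != 0 &
    forall v, v \in (vbasis {:V} : seq V) -> act T g v = 0.
  elim: (vbasis {:V} : seq V) => [|v vs [g g0 ann]].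
    by exists 1; rewrite ?oner_neq0.
  have [h h0 hv] := exists_vector_annihilator v.
  exists (g * h) => [|w]; first by rewrite mulf_neq0.
  rewrite inE actM => /predU1P[->|/ann gw]; first by rewrite hv linear0.
  by rewrite actCA gw linear0.
exists g => // v; rewrite (coord_vbasis (memvf v)) linear_sum big1 // => i _.
by rewrite linearZ /= ann ?scaler0 // mem_nth // size_tuple.
Qed.

(** Write g = h p^j with h prime to p. The coprime splitting of the indecomposable U is trivial, so
    either p^j kills U, or h does and the induction on the size of g applies. *)
Lemma indecomposable_primary_ann U g : indecomposable T U -> g != 0 ->
  (U <= lker (act T g))%VS ->
  exists p k, [/\ p \is monic, irreducible_poly p & (U <= lker (act T (p ^+ k)))%VS].
Proof.
move=> iU; have [U0 sU _] := iU; have [n] := ubnP (size g).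
elim: n g => // n IH g leqn g0 ann.
have [sg|sg] := leqP (size g) 1.
  case/eqP: U0; apply/eqP; rewrite -subv0; apply/subvP => u /(subvP ann).
  rewrite memv_ker memv0 (size1_polyC sg) actC scaler_eq0 -polyC_eq0.
  by rewrite -size1_polyC // (negPf g0).
have [p [mp ip pg]] := irreducible_factor sg.
have [j [h [gE cop]]] := irreducible_multiplicity ip g0.
have cop' := cop; have {}cop := coprimep_expr j cop.
rewrite gE in ann; have [e e0] := ker_coprime_split sU cop ann.
case: (indecomposable_split iU _ _ e e0); try exact: stable_cap_ker;
  move/capv_idPl=> ann'.
  apply: (IH h) => //; last by apply: contra_neq g0; rewrite gE => ->; rewrite mul0r.
  have h0 : h != 0 by apply: contra_neq g0; rewrite gE => ->; rewrite mul0r.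
  have j0 : (0 < j)%N.
    rewrite lt0n; apply: contraTneq pg => j0; rewrite gE j0 mulr1.
    by rewrite -irreducible_poly_coprime // coprimep_sym.
  rewrite -ltnS; apply: leq_trans leqn; rewrite ltnS gE size_mul //; last first.
    by rewrite expf_neq0 ?irredp_neq0.
  case: (size (p ^+ j)) (size_irr_pow_gt1 ip j0) => [|[|m]] //= _.
  by rewrite !addnS ltnS leq_addr.
by exists p, j.
Qed.

Lemma poly_orbit_limg n v : 
  forall u, u \in limg (linfun (@poly_orbit F V T 1 v n)) <->
    exists2 q : {poly F}, (size q <= n)%N & u = act T q v.
Proof.
move=> u; split=> [/memv_imgP[q _ ->]|[q sq ->]].
  by exists (q : {poly F}); rewrite ?lfunE /= /poly_orbit ?mul1r //; apply: size_npoly.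
apply/memv_imgP; exists (npolyp n q); rewrite ?memvf // lfunE /= /poly_orbit.
by rewrite npolypK // mul1r.
Qed.

Lemma cyclic_span v f : f != 0 -> (forall q, act T q v = 0 <-> f %| q) ->
  exists U, cyclic_on T U v f.
Proof.
move=> f0 aU; exists (limg (linfun (@poly_orbit F V T 1 v (size f).-1))).
split=> // u; rewrite poly_orbit_limg; split=> [[q _ ->]|[q ->]]; first by exists q.
exists (q %% f).
  by rewrite -ltnS prednK ?size_poly_gt0 // ltn_modp.
rewrite [in LHS](divp_eq q f) actD actM.
by rewrite (aU f).2 // linear0 add0r.
Qed.

(* As [act T f] vanishes on [U], the infinitely many conditions
   [lam (act T q u) = 0] reduce to the [deg f] ones with [q = 'X^j]. *)
Lemma functional_kernel U f (lam : 'Hom(V, F^o)) : stable T U -> f != 0 ->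
  (U <= lker (act T f))%VS ->
  exists W, [/\ (W <= U)%VS, stable T W,
    (\dim U <= (size f).-1 + \dim W)%N
    & forall w q, w \in W -> lam (act T q w) = 0].
Proof.
move=> sU f0 ann; set d := (size f).-1.
pose L (u : V) : 'rV[F]_d := \row_j lam (iter j T u).
have iterL n a u w : iter n T (a *: u + w) = a *: iter n T u + iter n T w.
  by elim: n => //= n ->; rewrite linearP.
have L_lin : linear L by move=> a u w; apply/rowP => j; rewrite !mxE iterL linearP.
pose LH : {linear V -> 'rV[F]_d} := HB.pack L (GRing.isLinear.Build _ _ _ _ L L_lin).
pose W := (U :&: lker (linfun LH))%VS.
have W0 w q : w \in W -> lam (act T q w) = 0.
  rewrite memv_cap memv_ker lfunE /= => /andP[Uw /eqP/rowP Lw].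
  have /eqP fw : act T f w == 0 by rewrite -memv_ker (subvP ann).
  rewrite (divp_eq q f) actD actM fw linear0 add0r.
  rewrite (actE T _ (n := d)); last by rewrite -ltnS prednK ?size_poly_gt0 // ltn_modp.
  rewrite linear_sum big1 // => i _; rewrite linearZ /=.
  by have := Lw i; rewrite !mxE => ->; rewrite scaler0.
exists W; split=> //; first exact: capvSl.
- apply: stableP => w Ww; rewrite memv_cap memv_ker lfunE /=.
  have Uw : w \in U by move: Ww; rewrite memv_cap => /andP[].
  rewrite -{1}actX stable_act //=; apply/eqP/rowP => j.
  by rewrite !mxE -iterSr -actXn W0.
- rewrite -(limg_ker_dim (linfun LH) U) addnC leq_add2r.
  apply: leq_trans (dimvS (subvf _)) _; rewrite dimvf dim_matrix.
  exact: eq_leq (mul1n d).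
Qed.

(** Take the least k such that p^k kills U, and v in U not killed by p^(k-1). The cyclic module C of
    v has a stable complement W in U, cut out by a functional that is nonzero on the socle of C;
    indecomposability then gives U = C. *)
Lemma indecomposable_primary_cyclic U : indecomposable T U ->
  exists f, primary_cyclic T U f.
Proof.
move=> iU; have [U0 sU _] := iU; have [g g0 ann] := exists_annihilator.
have annU : (U <= lker (act T g))%VS by apply/subvP => u _; rewrite memv_ker ann.
have [p [n [mp ip annp]]] := indecomposable_primary_ann iU g0 annU.
have exk : exists k, (U <= lker (act T (p ^+ k)))%VS by exists n.
case: (ex_minnP exk) => k annk mink.
have k0 : (0 < k)%N.
  rewrite lt0n; apply: contra U0 => /eqP k0; rewrite -subv0; apply/subvP => u.
  by move/(subvP annk); rewrite k0 memv_ker act1 memv0.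
have [v Uv nv] : exists2 v, v \in U & v \notin lker (act T (p ^+ k.-1)).
  by apply/subvPn/negP => /mink; rewrite -ltnS prednK // ltnn.
rewrite memv_ker in nv.
have kill u : u \in U -> act T (p ^+ k) u = 0.
  by move/(subvP annk); rewrite memv_ker => /eqP.
(* If q kills v but its p-part p^j has j < k, then Bezout makes p^j kill v, hence p^(k-1) as well,
   against the choice of v. *)
have aU q : act T q v = 0 <-> p ^+ k %| q.
  split=> [qv|]; last exact/act_dvd/kill.
  have [->|q0] := eqVneq q 0; first exact: dvdp0.
  have [j [h [qE cop]]] := irreducible_multiplicity ip q0.
  rewrite qE dvdp_mull // dvdp_exp2l // leqNgt; apply: contra nv => ltjk.
  have [a [b <-]] := bezout_act T (act T (p ^+ k.-1) v) (coprimep_expr k cop).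
  rewrite [act T (p ^+ k) _]actCA kill // !linear0 addr0.
  rewrite -[k.-1](@subnK j); last by rewrite -ltnS prednK.
  by rewrite exprD actM [act T h _]actCA -[act T h _]actM -qE qv !linear0.
have pk0 : p ^+ k != 0 by rewrite expf_neq0 ?irredp_neq0.
have [C cC] := cyclic_span pk0 aU.
have sC := cyclic_stable cC.
have CU : (C <= U)%VS.
  by apply/subvP => u; case: cC => _ mC _ /mC[q ->]; apply: stable_act.
have [lam lam0] := exists_functional nv.
have [W [WU sW dimW lamW]] := functional_kernel lam sU pk0 annk.
(* A nonzero u in C has a multiple equal to the socle generator, where [lam] is nonzero, while [lam]
   vanishes on all multiples of an element of W. *)
have CW0 : (C :&: W)%VS = 0%VS.
  apply/eqP; rewrite -subv0; apply/subvP => u /memv_capP[Cu Wu]; rewrite memv0.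
  apply: contraNT lam0 => u0; have [h <-] := cyclic_socle ip k0 cC Cu u0.
  by rewrite lamW.
(* W has codimension at most deg p^k = dim C in U, so the direct sum fills U. *)
have CWU : (C + W)%VS = U.
  apply/eqP; rewrite eqEdim subv_add CU WU /= dimv_disjoint_sum //.
  by rewrite (dim_cyclic cC).
exists (p ^+ k); exists v, p, k; split=> //.
case: (indecomposable_split iU sC sW CWU CW0) => [<-//|WE].
case/eqP: nv; have : v \in (C :&: W)%VS by rewrite memv_cap (cyclic_gen cC) WE.
by rewrite CW0 memv0 => /eqP->; rewrite linear0.
Qed.

(** Direct sum decompositions in recursive form, suited to induction on the list of divisors;
    [decomposedP] converts to indexed families. The parameter [P] allows indecomposability to be
    carried along or forgotten. *)
Fixpoint decomposed P U s : Prop :=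
  if s is f :: s' then
    exists U1 W, [/\ P U1 f, decomposed P W s', (U1 :&: W = 0)%VS & (U1 + W)%VS = U]
  else U = 0%VS.

Lemma decomposed_sub P Q U s : (forall W f, P W f -> Q W f) ->
  decomposed P U s -> decomposed Q U s.
Proof.
move=> PQ; elim: s U => //= f s IH U [U1 [W [/PQ ? /IH ? ? ?]]].
by exists U1, W.
Qed.

(** Reassociation of a direct sum, obtained by comparing the dimensions of both bracketings. *)
Lemma capv0_assoc U1 U2 W : (U1 :&: U2)%VS = 0%VS -> ((U1 + U2) :&: W)%VS = 0%VS ->
  (U2 :&: W)%VS = 0%VS /\ (U1 :&: (U2 + W))%VS = 0%VS.
Proof.
move=> c12 c; have := dimv_sum_cap (U1 + U2) W; have := dimv_sum_cap U1 U2.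
have := dimv_sum_cap U2 W; have := dimv_sum_cap U1 (U2 + W).
rewrite c c12 dimv0 addvA => e1 e2 e3 e4.
have z : (\dim (U2 :&: W) + \dim (U1 :&: (U2 + W)) = 0)%N by lia.
move/eqP: z; rewrite addn_eq0 !dimv_eq0 => /andP[/eqP-> /eqP->].
by [].
Qed.

Lemma decomposed_cat P U W s t : decomposed P U s -> decomposed P W t ->
  (U :&: W)%VS = 0%VS -> decomposed P (U + W) (s ++ t).
Proof.
elim: s U => /= [U -> dW _|f s IH _ [U1 [U2 [P1 d2 c12 <-]]] dW c].
  by rewrite add0v.
have [c2 c1] := capv0_assoc c12 c.
by exists U1, (U2 + W)%VS; split=> //; [apply: IH | rewrite addvA].
Qed.

Lemma decomposed_rem P U f s : f \in s -> decomposed P U s ->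
  exists U1 W, [/\ P U1 f, decomposed P W (rem f s), (U1 :&: W = 0)%VS
    & (U1 + W)%VS = U].
Proof.
elim: s U => //= g s IH U; have [<-//|ngf] := eqVneq g f.
rewrite inE eq_sym (negPf ngf) /= => fs [G [W [PG dW c <-]]].
have [U1 [W' [P1 dW' c1 WE]]] := IH _ fs dW; rewrite -WE in c.
have {}c : ((U1 + W') :&: G)%VS = 0%VS by rewrite capvC.
have [c2 c3] := capv0_assoc c1 c.
exists U1, (G + W')%VS; split=> //=; last by rewrite -WE !addvA [(G + U1)%VS]addvC.
  by exists G, W'; split=> //; rewrite capvC.
by rewrite [(G + _)%VS]addvC.
Qed.

(** Induction on the dimension: a nonzero space that is not indecomposable splits into two stable
    subspaces of smaller dimension. *)
Lemma exists_decomposed U : stable T U -> exists s,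
  decomposed (fun W f => indecomposable T W /\ primary_cyclic T W f) U s.
Proof.
have [n] := ubnP (\dim U); elim: n U => // n IH U leUn sU.
have [->|U0] := eqVneq U 0%VS; first by exists [::].
have [iU|niU] := classic (indecomposable T U).
  have [f pf] := indecomposable_primary_cyclic iU.
  by exists [:: f] => /=; exists U, 0%VS; rewrite capv0 addv0.
have [U1 [U2 [[s1 s2 eU c] U10 U20]]] : exists U1 U2, 
  [/\ [/\ stable T U1, stable T U2, (U1 + U2)%VS = U & (U1 :&: U2)%VS = 0%VS],
    U1 != 0%VS & U2 != 0%VS].
  apply: NNPP => H; apply: niU; split=> // U1 U2 s1 s2 eU c.
  have [|U10] := eqVneq U1 0%VS; first by left.
  have [|U20] := eqVneq U2 0%VS; first by right.
  by case: H; exists U1, U2.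
have dU := dimv_disjoint_sum c; rewrite eU in dU.
rewrite -dimv_eq0 in U10; rewrite -dimv_eq0 in U20.
have [t1 d1] : exists t, decomposed
    (fun W f => indecomposable T W /\ primary_cyclic T W f) U1 t.
  by apply: IH => //; lia.
have [t2 d2] : exists t, decomposed
    (fun W f => indecomposable T W /\ primary_cyclic T W f) U2 t.
  by apply: IH => //; lia.
by exists (t1 ++ t2); rewrite -eU; apply: decomposed_cat.
Qed.

Lemma decomposedP P U s : decomposed P U s <->
  exists U_ : 'I_(size s) -> {vspace V},
    [/\ (\sum_i U_ i)%VS = U, directv (\sum_i U_ i) & forall i, P (U_ i) s`_i].
Proof.
elim: s U => [|f s IH] U /=.
  split=> [->|[U_ [<- _ _]]]; last by rewrite big_ord0.
  exists (fun _ => 0%VS); split=> [|| []] //; first by rewrite big_ord0.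
  by rewrite directvE /= !big_ord0 dimv0.
split=> [[U1 [W [P1 /IH[W_ [WE dW PW]] c <-]]]|[U_ [<- dU PU]]].
  exists (fun i => if unlift ord0 i is Some j then W_ j else U1).
  have sumE : (\sum_(i < (size s).+1) (if unlift ord0 i is Some j then W_ j else U1)
     = U1 + W)%VS.
    rewrite big_ord_recl unlift_none -WE; congr (_ + _)%VS.
    by apply: eq_bigr => i _; rewrite liftK.
  split=> //.
    rewrite directvE /= sumE dimv_disjoint_sum // -WE (directvP dW) /=.
    rewrite big_ord_recl unlift_none; apply/eqP; congr (_ + _)%N.
    by apply: eq_bigr => i _; rewrite liftK.
  by move=> i; case: unliftP => [j ->|->] //=.
exists (U_ ord0), (\sum_i U_ (lift ord0 i))%VS.
move: dU; rewrite directvE /= !big_ord_recl => /eqP dU.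
set W := (\sum_(i < size s) U_ (lift ord0 i))%VS in dU *.
(* Both the sum with [U_ ord0] and the sum defining [W] can only lose dimension; since nothing is
   lost in total, neither loses any. *)
have leD : (\dim W <= \sum_(i < size s) \dim (U_ (lift ord0 i)))%N.
  exact: dimv_leq_sum.
have leS := dimv_sum_cap (U_ ord0) W.
have [cap0 dW] : \dim (U_ ord0 :&: W) = 0%N /\
  \dim W = (\sum_(i < size s) \dim (U_ (lift ord0 i)))%N.
  by move: leD leS dU; move: (\sum_(i < _) _)%N => N; split; lia.
split=> //; last by apply/eqP; rewrite -dimv_eq0 cap0.
apply/IH; exists (fun i => U_ (lift ord0 i)); split=> //.
  by rewrite directvE /= dW.
Qed.

End Decomposition.

(** * Multiplicities of elementary divisors from kernel dimensions *)

Section Multiplicity.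
Variables (F : fieldType) (V : vectType F) (T : 'End(V)).
Implicit Types (U W : {vspace V}) (p q f g h r : {poly F}) (u v w : V).
Implicit Types (s : seq {poly F}).

Lemma elementary_divisorsP s : elementary_divisors T s <->
  decomposed (fun W f => indecomposable T W /\ primary_cyclic T W f) fullv s.
Proof.
have pP W f : primary_piece T W f <-> primary_cyclic T W f.
  split=> [[p [k [mp ip k0 fE]]]|[v [p [k [mp ip k0 fE c]]]]].
    rewrite iso_quotient_cyclic ?fE ?monic_exp ?size_irr_pow_gt1 //.
    by case=> // v cv; exists v, p, k.
  exists p, k; split=> //; apply/iso_quotient_cyclic; last by exists v.
    by rewrite fE monic_exp.
  by rewrite fE size_irr_pow_gt1.
rewrite decomposedP; split=> -[U_ [sU dU PU]]; exists U_; split=> // i;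
  by have [? /pP] := PU i.
Qed.

Lemma exists_elementary_divisors : exists s, elementary_divisors T s.
Proof.
have [|s ds] := @exists_decomposed F V T fullv; first exact: subvf.
by exists s; apply/elementary_divisorsP.
Qed.

Lemma decomposed_stable U s : decomposed (primary_cyclic T) U s -> stable T U.
Proof.
elim: s U => [|f s IH] U /= => [->|[U1 [W [[v [p [k [_ _ _ _ c]]]] /IH sW _ <-]]]].
  exact: stable0.
by apply: stableD => //; apply: cyclic_stable c.
Qed.

(** The kernel of g(T) is the direct sum of its kernels on the pieces, each given by
    [dim_cyclic_ker]. *)
Lemma dim_decomposed_ker U s g : decomposed (primary_cyclic T) U s ->
  \dim (U :&: lker (act T g)) = (\sum_(f <- s) (size (gcdp f g)).-1)%N.
Proof.
elim: s U => [|f s IH] U /=; first by move=> ->; rewrite cap0v dimv0 big_nil.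
case=> U1 [W [[v [p [k [_ _ _ _ c]]]] dW cap0 <-]].
have sW := decomposed_stable dW; have s1 := cyclic_stable c.
rewrite big_cons -(IH W) // -(dim_cyclic_ker g c) -dimv_disjoint_sum; last first.
  apply/eqP; rewrite -subv0 -cap0; apply: capvS; exact: capvSl.
congr (\dim _); apply/eqP; rewrite eq_sym eqEsubv subv_add.
rewrite !capvS ?addvSl ?addvSr ?subvv //=.
apply/subvP => _ /memv_capP[/memv_addP[u1 U1u1 [w Ww ->]]].
rewrite memv_ker linearD /= addr_eq0 => /eqP e.
(* The two components of g(T)(u1 + w) = 0 are opposite, hence lie in U1 and W at once and vanish. *)
have z : act T g u1 \in (U1 :&: W)%VS.
  by rewrite memv_cap stable_act //= e memvN stable_act.
have {}z : act T g u1 = 0 by apply/eqP; rewrite -memv0 -cap0.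
have zw : act T g w = 0 by apply/eqP; rewrite -oppr_eq0 -e z.
by rewrite memv_add // memv_cap memv_ker ?z ?zw eqxx andbT.
Qed.

Lemma gcdp_irr_pow p q i j : p \is monic -> q \is monic ->
  irreducible_poly p -> irreducible_poly q ->
  (size (gcdp (q ^+ i) (p ^+ j))).-1 = ((q == p) * (minn i j * (size p).-1))%N.
Proof.
move=> mp mq ip iq; have [->|nqp] := eqVneq q p.
  by rewrite mul1n (eqp_size (gcdp_exp _ _ _)) size_exp mulnC.
rewrite mul0n; suff /eqP-> : coprimep (q ^+ i) (p ^+ j) by [].
apply/coprimep_expl/coprimep_expr; rewrite irreducible_poly_coprime //.
apply: contra nqp => qp; rewrite -eqp_monic // apply_irredp //.
by have := irreducible_size iq; case: (size q) => [|[]].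
Qed.

(* Multiplicities are second differences of [k |-> \dim (ker p(T)^k)]; the
   negative term is moved across since the identity is over [nat]. *)
Lemma multiplicity_dim s p k : elementary_divisors T s ->
  p \is monic -> irreducible_poly p ->
  (count_mem (p ^+ k.+1) s * (size p).-1 + \dim (lker (act T (p ^+ k.+2)))
    + \dim (lker (act T (p ^+ k))) = 2 * \dim (lker (act T (p ^+ k.+1))))%N.
Proof.
move=> /elementary_divisorsP ds mp ip.
have {}ds : decomposed (primary_cyclic T) fullv s.
  by apply: decomposed_sub ds => W f [].
have kE j : \dim (lker (act T (p ^+ j))) = (\sum_(f <- s) (size (gcdp f (p ^+ j))).-1)%N.
  by rewrite -(dim_decomposed_ker _ ds) capfv.
have all_p f : f \in s -> exists q i,
    [/\ q \is monic, irreducible_poly q, (0 < i)%N & f = q ^+ i].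
  elim: s fullv {kE} ds => //= g s IH U [U1 [W [[v [q [i [mq iq i0 gE _]]]] dW _ _]]].
  rewrite inE => /predU1P[->|]; last exact: IH dW.
  by exists q, i.
rewrite !kE -sum1_count big_mkcond big_distrl big_distrr -!big_split /=.
rewrite !big_seq; apply: eq_bigr => f /all_p[q [i [mq iq i0 ->]]].
rewrite !gcdp_irr_pow //; have [->|nqp] := eqVneq q p; last first.
  (* For q distinct from p all gcd terms vanish; q^i = p^(k+1) is excluded because its gcd with
     itself has positive degree. *)
  rewrite !mul0n addn0 muln0 addn0; case: eqP => // e; exfalso.
  have := gcdp_irr_pow i k.+1 mp mq ip iq; rewrite (negPf nqp) e gcdpp.
  by rewrite size_exp mul0n => /eqP; rewrite muln_eq0 orbF -leqn0 leqNgt irreducible_size.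
have -> : (p ^+ i == p ^+ k.+1) = (i == k.+1).
  apply/eqP/eqP => [/(congr1 (fun f => (size f).-1))|->//].
  by rewrite !size_exp => /eqP; rewrite eqn_pmul2l ?irreducible_size // => /eqP.
(* The second difference of k |-> min(i, k) is concentrated at k + 1 = i. *)
have e : ((if i == k.+1 then 1 else 0) + minn i k.+2 + minn i k = 2 * minn i k.+1)%N.
  by case: eqP; lia.
by rewrite !mul1n -!mulnDl e mulnA.
Qed.

(** The part of Krull-Schmidt that is needed: the kernel dimensions do not depend on the
    decomposition, and deg p > 0 can be cancelled. *)
Lemma multiplicity_unique s t p k : elementary_divisors T s ->
  elementary_divisors T t -> p \is monic -> irreducible_poly p ->
  count_mem (p ^+ k.+1) s = count_mem (p ^+ k.+1) t.
Proof.
move=> ds dt mp ip.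
have := multiplicity_dim k ds mp ip; have := multiplicity_dim k dt mp ip.
by have := irreducible_size ip; nia.
Qed.

Lemma elementary_divisors_primary s f : elementary_divisors T s -> f \in s ->
  exists p k, [/\ p \is monic, irreducible_poly p & f = p ^+ k.+1].
Proof.
move=> /elementary_divisorsP ds fs.
have [U1 [W [[_ [v [p [k [mp ip k0 fE _]]]]] _ _ _]]] := decomposed_rem fs ds.
by exists p, k.-1; rewrite prednK.
Qed.

End Multiplicity.

(** * Conjugate-reversed polynomials and the dual *)

Section ConjugateReverse.
Variables (F : fieldType) (c : {rmorphism F -> F}).
Hypothesis cK : involutive c.
Implicit Types (p q f g h : {poly F}).

(** This is x^n q^c(1/x). Fixing a nominal degree [n], instead of the degree of [q], makes the
    operation additive, and multiplicative when nominal degrees add up. *)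
Definition crev n q : {poly F} := \poly_(i < n.+1) c q`_(n - i).

Lemma coef_crev n q i : (crev n q)`_i = if (i <= n)%N then c q`_(n - i) else 0.
Proof. by rewrite coef_poly ltnS. Qed.

Lemma size_crev n q : (size (crev n q) <= n.+1)%N.
Proof. exact: size_poly. Qed.

Lemma crevK n q : (size q <= n.+1)%N -> crev n (crev n q) = q.
Proof.
move=> sq; apply/polyP => i; rewrite !coef_crev leq_subr; case: leqP => [le_in|lt_ni].
  by rewrite cK subKn.
by rewrite nth_default // (leq_trans sq).
Qed.

Lemma crevD n p q : crev n (p + q) = crev n p + crev n q.
Proof.
apply/polyP => i; rewrite coefD !coef_crev coefD rmorphD /=.
by case: ifP; rewrite ?addr0.
Qed.

Lemma crevZ n a p : crev n (a *: p) = c a *: crev n p.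
Proof.
apply/polyP => i; rewrite coefZ !coef_crev coefZ rmorphM /=.
by case: ifP; rewrite ?mulr0.
Qed.

Lemma crev0 n : crev n 0 = 0.
Proof. by apply/polyP => i; rewrite coef_crev !coef0 rmorph0 if_same. Qed.

Lemma crev_sum n (I : Type) (r : seq I) (G : I -> {poly F}) :
  crev n (\sum_(i <- r) G i) = \sum_(i <- r) crev n (G i).
Proof.
by apply: (big_morph (crev n)) => [p q|]; rewrite ?crevD ?crev0.
Qed.

Lemma crev_XnM n m i q : (i <= n)%N -> (size q <= m.+1)%N ->
  crev (n + m) ('X^i * q) = 'X^(n - i) * crev m q.
Proof.
move=> le_in sq; apply/polyP => k; rewrite coef_crev !coefXnM coef_crev.
have [lt_kn|le_nk] := ltnP k (n - i).
  case: ifP => // _; case: ifP; rewrite ?rmorph0 // => _.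
  by rewrite nth_default ?rmorph0 // (leq_trans sq) //; lia.
have [le1|lt1] := leqP k (n + m); last by rewrite ifF //; apply/negP; lia.
have [lt2|le2] := ltnP (n + m - k) i.
  by rewrite rmorph0 ifF //; apply/negP; lia.
rewrite ifT; last by lia.
by congr (c q`_ _); lia.
Qed.

(** By additivity in [p] the claim reduces to monomials, which is [crev_XnM]. *)
Lemma crevM n m p q : (size p <= n.+1)%N -> (size q <= m.+1)%N ->
  crev (n + m) (p * q) = crev n p * crev m q.
Proof.
move=> sp sq; have pE : p = \sum_(i < n.+1) p`_i *: 'X^i.
  rewrite -poly_def; apply/polyP => i; rewrite coef_poly.
  by case: ltnP => // lt_ni; rewrite nth_default // (leq_trans sp).
rewrite pE big_distrl !crev_sum big_distrl /=; apply: eq_bigr => i _.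
have le_in : (i <= n)%N by rewrite -ltnS.
rewrite -scalerAl !crevZ crev_XnM // -scalerAl; congr (_ *: (_ * _)).
have := crev_XnM (m := 0) (q := 1) le_in; rewrite addn0 mulr1 size_poly1 => -> //.
have -> : crev 0 1 = 1.
  by apply/polyP => -[|j]; rewrite coef_crev !coef1 /= ?rmorph1.
by rewrite mulr1.
Qed.

Lemma dualE f : f != 0 -> dual c f = (c f.[0])^-1 *: crev (size f).-1 f.
Proof. by move=> f0; rewrite /dual /crev prednK ?size_poly_gt0. Qed.

Lemma root0_neq0 f : f.[0] != 0 -> f != 0.
Proof. by apply: contra_neq => ->; rewrite horner0. Qed.

Lemma conj_neq0 a : a != 0 -> (c a)^-1 != 0.
Proof. by rewrite invr_eq0 fmorph_eq0. Qed.

Lemma size_dual f : f.[0] != 0 -> size (dual c f) = size f.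
Proof.
move=> f0; have nf := root0_neq0 f0; rewrite dualE // size_scale ?conj_neq0 //.
have sf : (0 < size f)%N by rewrite size_poly_gt0.
have les := size_crev (size f).-1 f; rewrite prednK // in les.
apply/eqP; rewrite eqn_leq les leqNgt /=; apply/negP => lts.
have : (crev (size f).-1 f)`_(size f).-1 = 0 by rewrite nth_default // -ltnS prednK.
by rewrite coef_crev leqnn subnn -horner_coef0 => /eqP; rewrite fmorph_eq0 (negPf f0).
Qed.

Lemma dual_monic f : f.[0] != 0 -> dual c f \is monic.
Proof.
move=> f0; rewrite monicE lead_coefE size_dual // dualE ?root0_neq0 //.
by rewrite coefZ coef_crev leqnn subnn -horner_coef0 mulVf ?fmorph_eq0.
Qed.

Lemma dual_root0 f : f.[0] != 0 -> (dual c f).[0] = (c f.[0])^-1 * c (lead_coef f).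
Proof.
move=> f0; rewrite dualE ?root0_neq0 // hornerZ.
by rewrite [X in _ * X]horner_coef0 coef_crev subn0.
Qed.

Lemma dual_root0_neq0 f : f.[0] != 0 -> (dual c f).[0] != 0.
Proof.
move=> f0; rewrite dual_root0 // mulf_neq0 ?conj_neq0 // fmorph_eq0 lead_coef_eq0.
exact: root0_neq0.
Qed.

Lemma dualK f : f \is monic -> f.[0] != 0 -> dual c (dual c f) = f.
Proof.
move=> mf f0; have d0 := dual_root0_neq0 f0.
rewrite (dualE (root0_neq0 d0)) size_dual // dual_root0 // (monicP mf) rmorph1 mulr1.
rewrite dualE ?root0_neq0 // crevZ crevK ?leqSpred // !fmorphV cK invrK scalerA.
by rewrite mulfV // scale1r.
Qed.

Lemma dualM p q : p.[0] != 0 -> q.[0] != 0 -> dual c (p * q) = dual c p * dual c q.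
Proof.
move=> p0 q0; have np := root0_neq0 p0; have nq := root0_neq0 q0.
have sp : (0 < size p)%N by rewrite size_poly_gt0.
have sq : (0 < size q)%N by rewrite size_poly_gt0.
rewrite !dualE ?mulf_neq0 // hornerM rmorphM invfM size_mul //.
have -> : (size p + size q).-1.-1 = ((size p).-1 + (size q).-1)%N by lia.
by rewrite crevM ?leqSpred // -scalerAl -scalerAr scalerA.
Qed.

Lemma dual1 : dual c 1 = 1.
Proof.
rewrite dualE ?oner_neq0 // hornerC rmorph1 invr1 scale1r size_poly1.
by apply/polyP => -[|j]; rewrite coef_crev !coef1 /= ?rmorph1.
Qed.

Lemma dual_exp p k : p.[0] != 0 -> dual c (p ^+ k) = dual c p ^+ k.
Proof.
move=> p0; elim: k => [|k IH]; first exact: dual1.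
by rewrite !exprS dualM ?IH // horner_exp expf_neq0.
Qed.

(** Duality is multiplicative and preserves sizes, so a divisor of the dual of p yields a divisor of
    p of the same size. Only sizes are compared, since the divisor [h] need not be monic. *)
Lemma dual_irreducible p : p \is monic -> p.[0] != 0 ->
  irreducible_poly p -> irreducible_poly (dual c p).
Proof.
move=> mp p0 [sp ip]; split=> [|h h1 hd]; first by rewrite size_dual.
have [e eE] := dvdpP _ _ hd.
have := dual_root0_neq0 p0; rewrite eE hornerM mulf_eq0 negb_or => /andP[e0 h0].
have hp : dual c h %| p by rewrite -(dualK mp p0) eE dualM // dvdp_mull.
have := ip (dual c h); rewrite size_dual // => /(_ h1 hp) /eqp_size.
by rewrite size_dual // => sh; rewrite -eE -dvdp_size_eqp // sh size_dual.
Qed.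

(** The condition on [a] holds for 1 and -1, which covers the self-dual factors x - 1 and x + 1. *)
Lemma dual_linear a : a != 0 -> c a * a = 1 -> dual c ('X - a%:P) = 'X - a%:P.
Proof.
move=> a0 ca; rewrite dualE ?polyXsubC_eq0 // size_XsubC /= hornerXsubC sub0r.
apply/polyP => i; rewrite coefZ coef_crev !coefB !coefX !coefC.
case: i => [|[|i]] /=.
- by rewrite !subr0 sub0r rmorph1 mulr1 rmorphN invrN; congr (- _); exact: mulr1_eq.
- by rewrite sub0r subr0 mulVf // fmorph_eq0 oppr_eq0.
- by rewrite mulr0 subr0.
Qed.

End ConjugateReverse.

(** * Adjoints with respect to an invariant form, and necessity of the condition *)

Section InvariantForm.
Variables (F : fieldType) (c : {rmorphism F -> F}) (V : vectType F) (T : 'End(V)).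
Hypotheses (cK : involutive c) (kerT : lker T == 0%VS).
Implicit Types (U W : {vspace V}) (p q f g h : {poly F}) (u v w : V).

(* The conjugate-adjoint of [act T q] for any [T]-invariant form. *)
Definition act_adj q : 'End(V) := act (T^-1)%VF (map_poly c q).

Lemma act_adjD p q u : act_adj (p + q) u = act_adj p u + act_adj q u.
Proof. by rewrite /act_adj rmorphD actD. Qed.

Lemma act_adjZ a q u : act_adj (a *: q) u = c a *: act_adj q u.
Proof. by rewrite /act_adj map_polyZ actZ. Qed.

Lemma act_adjM p q u : act_adj (p * q) u = act_adj p (act_adj q u).
Proof. by rewrite /act_adj rmorphM actM. Qed.

Lemma act_adjC a u : act_adj a%:P u = c a *: u.
Proof. by rewrite /act_adj map_polyC actC. Qed.

Lemma act_adjMX q u : act_adj (q * 'X) u = (T^-1)%VF (act_adj q u).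
Proof. by rewrite /act_adj rmorphM /= map_polyX actMX. Qed.

(** The factor T^n clears the negative powers of T in q^c(T^-1). *)
Lemma iter_act_adj n q u : (size q <= n.+1)%N ->
  iter n T (act_adj q u) = act T (crev c n q) u.
Proof.
move=> sq; have sqc : (size (map_poly c q) <= n.+1)%N by rewrite size_map_poly.
rewrite (actE T _ (size_crev c n q)) (reindex_inj rev_ord_inj) /=.
rewrite /act_adj (actE _ _ sqc) -actXn linear_sum /=; apply: eq_bigr => i _.
have le_in : (i <= n)%N by rewrite -ltnS.
rewrite linearZ /= coef_map coef_crev subSS leq_subr subKn //; congr (_ *: _).
rewrite actXn -{1}(subnK le_in) iterD; congr (iter _ T _).
elim: (i : nat) u => // m IH u.
by rewrite iterSr [iter m.+1 _ u]iterS lker0_lfunVK.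
Qed.

Lemma iter_inj0 n u : iter n T u = 0 -> u = 0.
Proof.
elim: n => //= n IH e; apply: IH; move/lker0P: kerT; apply.
by rewrite e linear0.
Qed.

(** If f = g x, then injectivity of T shows that g already kills v, so f divides the shorter
    polynomial g. *)
Lemma cyclic_root0 U v f : cyclic_on T U v f -> (1 < size f)%N -> f.[0] != 0.
Proof.
case=> f0 _ aU sf; apply/negP => f00; have : root f 0 by [].
rewrite root_factor_theorem subr0 => /dvdpP[g fE].
have g0 : g != 0 by apply: contra_neq f0; rewrite fE => ->; rewrite mul0r.
have : act T f v = 0 by apply/aU.
rewrite fE actMX => /(@iter_inj0 1)/aU /(dvdp_leq g0).
by rewrite fE size_mulX // ltnn.
Qed.

(** Hermitian forms as plain functions, convenient for constructions; conjugate-linearity in the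
    second argument follows from the symmetry. *)
Definition hermitian_map (sigma : V -> V -> F) : Prop :=
  (forall a u v w, sigma (a *: u + v) w = a * sigma u w + sigma v w) /\
  (forall u w, sigma u w = c (sigma w u)).

Section Adjunction.
Variable sigma : V -> V -> F.
Hypotheses (herm : hermitian_map sigma) (inv : T_invariant T sigma).

Lemma herm_Dl u v w : sigma (u + v) w = sigma u w + sigma v w.
Proof. by rewrite -{1}[u]scale1r herm.1 mul1r. Qed.

Lemma herm_0l w : sigma 0 w = 0.
Proof. by apply: (addrI (sigma 0 w)); rewrite -herm_Dl !addr0. Qed.

Lemma herm_Zl a u w : sigma (a *: u) w = a * sigma u w.
Proof. by rewrite -[a *: u]addr0 herm.1 herm_0l addr0. Qed.

Lemma herm_Dr u v w : sigma w (u + v) = sigma w u + sigma w v.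
Proof. by rewrite herm.2 herm_Dl rmorphD -!herm.2. Qed.

Lemma herm_Zr a u w : sigma w (a *: u) = c a * sigma w u.
Proof. by rewrite herm.2 herm_Zl rmorphM -herm.2. Qed.

(** Invariance gives sigma(Tu, w) = sigma(u, T^-1 w), and scalars change sides through c; the rest
    is induction on q. *)
Lemma act_adjoint q u w : sigma (act T q u) w = sigma u (act_adj q w).
Proof.
elim/poly_ind: q w => [|q a IH] w.
  rewrite act0 herm_0l /act_adj rmorph0 act0.
  by rewrite herm.2 herm_0l rmorph0.
rewrite actD actMX actC herm_Dl herm_Zl act_adjD act_adjMX act_adjC herm_Dr herm_Zr cK.
rewrite -{1}(lker0_lfunVK kerT w) inv IH; congr (sigma u _ + _).
by rewrite -!(actX (T^-1)%VF) /act_adj actCA.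
Qed.

Hypothesis nondeg : forall u, (forall w, sigma u w = 0) -> u = 0.

(** The orthogonal of the image of q(T) has dimension at least dim ker q(T). By nondegeneracy the
    adjoint kills it, and so does [crev c n q]. *)
Lemma leq_dim_ker_crev n q : (size q <= n.+1)%N ->
  (\dim (lker (act T q)) <= \dim (lker (act T (crev c n q))))%N.
Proof.
move=> sq; set U := limg (act T q).
(* The variable [w] occupies the first slot, where the form is linear; symmetry gives orthogonality
   in the other slot. *)
pose L (w : V) : 'rV[F]_(\dim U) := \row_i sigma w (vbasis U)`_i.
have L_lin : linear L by move=> a u w; apply/rowP => j; rewrite !mxE herm.1.
pose LH : {linear V -> 'rV[F]_(\dim U)} :=
  HB.pack L (GRing.isLinear.Build _ _ _ _ L L_lin).
have dimU := limg_ker_dim (act T q) fullv; rewrite capfv in dimU.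
have dimL := limg_ker_dim (linfun LH) fullv; rewrite capfv in dimL.
have leL : (\dim (limg (linfun LH)) <= \dim U)%N.
  apply: leq_trans (dimvS (subvf _)) _; rewrite dimvf dim_matrix.
  exact: eq_leq (mul1n _).
apply: (@leq_trans (\dim (lker (linfun LH)))).
  by move: dimU dimL leL; rewrite -/U; lia.
apply/dimvS/subvP => w; rewrite !memv_ker lfunE /= => /eqP/rowP Lw.
have orth x : x \in U -> sigma x w = 0.
  move=> /coord_vbasis->.
  apply: (big_ind (fun y => sigma y w = 0)) => [|y z|i _]; first exact: herm_0l.
    by rewrite herm_Dl => -> ->; rewrite addr0.
  by move: (Lw i); rewrite !mxE herm_Zl => e; rewrite herm.2 e rmorph0 mulr0.
rewrite -iter_act_adj //; suff -> : act_adj q w = 0.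
  by rewrite -actXn linear0.
apply: nondeg => u; rewrite herm.2 -act_adjoint orth ?rmorph0 //.
by apply: memv_img; apply: memvf.
Qed.

Lemma dim_ker_dual q : q.[0] != 0 ->
  \dim (lker (act T (dual c q))) = \dim (lker (act T q)).
Proof.
move=> q0; have -> : lker (act T (dual c q)) = lker (act T (crev c (size q).-1 q)).
  apply/vspaceP => u; rewrite !memv_ker dualE ?root0_neq0 // actZ scaler_eq0.
  by rewrite (negPf (conj_neq0 c q0)).
apply/eqP; rewrite eqn_leq leq_dim_ker_crev ?leqSpred // andbT.
by have := leq_dim_ker_crev (size_crev c (size q).-1 q); rewrite crevK // leqSpred.
Qed.

(** The kernel dimensions agree for p^n and its dual for every n, and both primes have the same
    degree, so [multiplicity_dim] gives equal counts. *)
Lemma count_dual s p k : elementary_divisors T s -> p \is monic ->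
  irreducible_poly p -> p.[0] != 0 ->
  count_mem (dual c (p ^+ k.+1)) s = count_mem (p ^+ k.+1) s.
Proof.
move=> ds mp ip p0; have p0n n : (p ^+ n).[0] != 0 by rewrite horner_exp expf_neq0.
have := multiplicity_dim k ds mp ip.
have := multiplicity_dim k ds (dual_monic c p0) (dual_irreducible cK mp p0 ip).
rewrite -(dual_exp c k p0) -(dual_exp c k.+1 p0) -(dual_exp c k.+2 p0).
rewrite (dim_ker_dual (p0n k)) (dim_ker_dual (p0n k.+1)) (dim_ker_dual (p0n k.+2)).
rewrite size_dual // => <- /eqP.
by rewrite !eqn_add2r eqn_pmul2r ?irreducible_size // => /eqP.
Qed.

End Adjunction.

Lemma elementary_divisors_root0 s p k : elementary_divisors T s ->
  p ^+ k.+1 \in s -> p.[0] != 0.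
Proof.
move=> /elementary_divisorsP ds fs.
have [U1 [W [[_ [v [q [j [mq iq j0 fE cU]]]]] _ _ _]]] := decomposed_rem fs ds.
have := cyclic_root0 cU; rewrite fE size_irr_pow_gt1 // -fE horner_exp => /(_ isT).
by rewrite expf_eq0.
Qed.

(** Powers of x - 1 and x + 1 are not [dualizable], yet the formula for the dual fixes them too,
    which unifies the three cases of [self_dual]. *)
Lemma dual_fixed f : self_dual c f -> dual c f = f.
Proof.
have dX a k : a != 0 -> c a * a = 1 -> dual c (('X - a%:P) ^+ k) = ('X - a%:P) ^+ k.
  move=> a0 ca; rewrite dual_exp ?dual_linear //.
  by rewrite hornerXsubC sub0r oppr_eq0.
case=> [[k ->]|[k ->]|[_ <-//]].
  by rewrite -polyC1 dX ?oner_neq0 // rmorph1 mulr1.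
have -> : 'X + 1 = 'X - (-1)%:P :> {poly F} by rewrite polyCN opprK polyC1.
by rewrite dX ?oppr_eq0 ?oner_neq0 // rmorphN1 mulrNN mulr1.
Qed.

End InvariantForm.

(** * Construction of invariant forms, and sufficiency of the condition *)

Section FormConstruction.
Variables (F : fieldType) (c : {rmorphism F -> F}) (V : vectType F) (T : 'End(V)).
Hypotheses (cK : involutive c) (kerT : lker T == 0%VS).
Implicit Types (U W : {vspace V}) (p q f g h : {poly F}) (u v w : V).
Implicit Types (sigma B : V -> V -> F).

(** The form lives on all of V, but invariance and nondegeneracy are only required on U; this avoids
    forms on subspace types. *)
Definition has_form_on U : Prop :=
  exists sigma, [/\ hermitian_map c sigma,
    {in U &, forall u w, sigma (T u) (T w) = sigma u w}
    & forall u, u \in U -> (forall w, w \in U -> sigma u w = 0) -> u = 0].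

Lemma act_adj_T q u : act_adj c T q (T u) = T (act_adj c T q u).
Proof.
apply: (can_inj (lker0_lfunVK kerT)); rewrite (lker0_lfunK kerT).
by rewrite /act_adj -(actX (T^-1)%VF) actCA actX (lker0_lfunK kerT).
Qed.

Lemma daddv_pi_sum U1 U2 u w : (U1 :&: U2)%VS = 0%VS -> u \in U1 -> w \in U2 ->
  daddv_pi U1 U2 (u + w) = u.
Proof.
move=> c0 Uu Uw; rewrite linearD /= daddv_pi_id //.
have := daddv_pi_add c0 (subvP (addvSr U1 U2) _ Uw).
rewrite (daddv_pi_id (U := U2)) // 1?capvC // => /(canRL (addrK _)).
by rewrite subrr => ->; rewrite addr0.
Qed.

Lemma daddv_pi_sumr U1 U2 u w : (U1 :&: U2)%VS = 0%VS -> u \in U1 -> w \in U2 ->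
  daddv_pi U2 U1 (u + w) = w.
Proof. by move=> c0 Uu Uw; rewrite addrC daddv_pi_sum // capvC. Qed.

Lemma has_form_on0 : has_form_on 0.
Proof.
exists (fun _ _ => 0); split=> [| //|u].
  by split=> *; rewrite ?mulr0 ?addr0 ?rmorph0.
by rewrite memv0 => /eqP.
Qed.

(** The orthogonal sum, with each form pulled back along the projection onto its summand. *)
Lemma has_form_onD U1 U2 : stable T U1 -> stable T U2 -> (U1 :&: U2)%VS = 0%VS ->
  has_form_on U1 -> has_form_on U2 -> has_form_on (U1 + U2).
Proof.
move=> st1 st2 c0 [s1 [h1 i1 n1]] [s2 [h2 i2 n2]].
pose p1 := daddv_pi U1 U2; pose p2 := daddv_pi U2 U1.
exists (fun u w => s1 (p1 u) (p1 w) + s2 (p2 u) (p2 w)); split.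
- split=> [a u v w|u w]; last by rewrite rmorphD -h1.2 -h2.2.
  by rewrite !linearP h1.1 h2.1 mulrDr addrACA.
- move=> _ _ /memv_addP[u1 Uu1 [u2 Uu2 ->]] /memv_addP[w1 Uw1 [w2 Uw2 ->]].
  have st (W : {vspace V}) x : stable T W -> x \in W -> T x \in W.
    by move=> sW Wx; rewrite -(actX T x) stable_act.
  rewrite ![T (_ + _)]linearD /= /p1 /p2 !(daddv_pi_sum c0) ?(daddv_pi_sumr c0) ?st //.
  by rewrite i1 // i2.
- move=> _ /memv_addP[u1 Uu1 [u2 Uu2 ->]] rad.
  have -> : u1 = 0.
    apply: n1 => // w Uw.
    have := rad (w + 0); rewrite {1}addr0 => /(_ (subvP (addvSl U1 U2) _ Uw)).
    rewrite /p1 /p2 !(daddv_pi_sum c0) ?(daddv_pi_sumr c0) ?mem0v //.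
    by rewrite h2.2 (herm_0l h2) rmorph0 addr0.
  have -> : u2 = 0.
    apply: n2 => // w Uw.
    have := rad (0 + w); rewrite {1}add0r => /(_ (subvP (addvSr U1 U2) _ Uw)).
    rewrite /p1 /p2 !(daddv_pi_sum c0) ?(daddv_pi_sumr c0) ?mem0v //.
    by rewrite h1.2 (herm_0l h1) rmorph0 !add0r.
  by rewrite addr0.
Qed.

Definition sesquilinear_map B : Prop :=
  (forall a u v w, B (a *: u + v) w = a * B u w + B v w) /\
  (forall a u v w, B w (a *: u + v) = c a * B w u + B w v).

Lemma sesqui_0l B w : sesquilinear_map B -> B 0 w = 0.
Proof.
by move=> sB; have := sB.1 (-1) 0 0 w; rewrite scaler0 addr0 mulN1r addNr.
Qed.

Lemma sesqui_0r B w : sesquilinear_map B -> B w 0 = 0.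
Proof.
by move=> sB; have := sB.2 (-1) 0 0 w; rewrite scaler0 addr0 rmorphN1 mulN1r addNr.
Qed.

Lemma sesqui_hermitian B b : sesquilinear_map B ->
  hermitian_map c (fun u w => b * B u w + c (b * B w u)).
Proof.
move=> sB; split=> [a u v w|u w].
  rewrite sB.1 sB.2 mulrDr [b * (c a * _ + _)]mulrDr !rmorphD !rmorphM cK; ring.
by rewrite rmorphD cK addrC.
Qed.

(** The left radical is closed under T, because every w in W is T w' with w' in W and B is
    invariant. If nonzero it therefore contains the socle generator. *)
Lemma radical_socle B U W v p k u : irreducible_poly p -> (0 < k)%N ->
  cyclic_on T U v (p ^+ k) -> stable T W ->
  (forall a u v w, B (a *: u + v) w = a * B u w + B v w) ->
  {in U & W, forall u w, B (T u) (T w) = B u w} ->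
  u \in U -> u != 0 -> (forall w, w \in W -> B u w = 0) ->
  forall w, w \in W -> B (act T (p ^+ k.-1) v) w = 0.
Proof.
move=> ip k0 cU sW linB invB Uu u0 rad; have [g <-] := cyclic_socle ip k0 cU Uu u0.
have sU := cyclic_stable cU; elim/poly_ind: g => [|g a IH] w Ww.
  by have := linB (-1) 0 0 w; rewrite act0 scaler0 addr0 mulN1r addNr.
rewrite actD actMX actC -[T _]scale1r linB mul1r -[a *: u]addr0 linB rad // mulr0 add0r.
have B0 : B 0 w = 0.
  by have := linB (-1) 0 0 w; rewrite scaler0 addr0 mulN1r addNr.
rewrite B0 addr0; move: Ww; rewrite -{1}(limg_stable sW kerT) => /memv_imgP[w' Ww' ->].
by rewrite invB ?IH // stable_act.
Qed.

Section Pairing.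
Variables (U1 U2 : {vspace V}) (v1 v2 : V) (f : {poly F}) (lam : 'Hom(V, F^o)).
Hypotheses (cU1 : cyclic_on T U1 v1 f) (f0 : f.[0] != 0).
Hypothesis cU2 : cyclic_on T U2 v2 (dual c f).

Lemma act_adj_dual0 u : u \in U1 -> act_adj c T (dual c f) u = 0.
Proof.
move=> Uu; apply: (@iter_inj0 _ _ _ kerT (size f).-1).
rewrite iter_act_adj // ?size_dual ?leqSpred // dualE ?root0_neq0 // crevZ.
by rewrite crevK ?leqSpred // actZ (cyclic_ann cU1) ?scaler0.
Qed.

(** The right-hand side depends only on q modulo the dual of f, by [act_adj_dual0]. Hence a linear
    choice [rho w] of representing polynomial defines B. *)
Lemma exists_pairing : exists2 B, sesquilinear_map B
  & forall u q, u \in U1 -> B u (act T q v2) = lam (act_adj c T q u).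
Proof.
pose n := (size (dual c f)).-1; pose phi := linfun (@poly_orbit F V T 1 v2 n).
pose rho w : {poly F} := polyn ((phi^-1)%VF w).
have rho_lin a u w : rho (a *: u + w) = a *: rho u + rho w by rewrite /rho linearP.
have rhoK q : act T (rho (act T q v2)) v2 = act T q v2.
  have : act T q v2 \in limg phi.
    apply/poly_orbit_limg; exists (q %% dual c f); last exact: cyclic_mod cU2.
    rewrite -ltnS prednK ?size_poly_gt0 ?ltn_modp; by case: cU2.
  by move/limg_lfunVK => {2}<-; rewrite lfunE /= /poly_orbit mul1r.
exists (fun u w => lam (act_adj c T (rho w) u)).
  split=> a u v w; first by rewrite !linearP.
  by rewrite rho_lin act_adjD act_adjZ linearP.
move=> u q Uu /=; set r := rho _.
have /dvdpP[h e] : dual c f %| r - q.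
  by case: cU2 => _ _ <-; rewrite actD actN rhoK subrr.
by rewrite -[r](subrK q) e act_adjD act_adjM act_adj_dual0 // linear0 add0r.
Qed.

Variable B : V -> V -> F.
Hypotheses (sB : sesquilinear_map B).
Hypothesis BE : forall u q, u \in U1 -> B u (act T q v2) = lam (act_adj c T q u).

Lemma pairing_invariant : {in U1 & U2, forall u w, B (T u) (T w) = B u w}.
Proof.
move=> u w Uu; case: cU2 => _ mU2 _ /mU2[q ->].
have sU1 := cyclic_stable cU1.
rewrite -actMX !BE //; last by rewrite -(actX T) stable_act.
by rewrite act_adjMX act_adj_T (lker0_lfunK kerT).
Qed.

Lemma pairing_gen u : u \in U1 -> B u v2 = lam u.
Proof. by move=> Uu; rewrite -(act1 T v2) BE // act_adjC rmorph1 scale1r. Qed.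

Variables (p : {poly F}) (k : nat).
Hypotheses (ip : irreducible_poly p) (k0 : (0 < k)%N) (fE : f = p ^+ k).
Hypothesis lam0 : lam (act T (p ^+ k.-1) v1) != 0.

Lemma pairing_nondegl u : u \in U1 -> (forall w, w \in U2 -> B u w = 0) -> u = 0.
Proof.
move=> Uu rad; apply/eqP; apply: contraNT lam0 => u0.
have cU1' := cU1; rewrite fE in cU1'.
have sU1 := cyclic_stable cU1; have Uv1 := cyclic_gen cU1.
have := radical_socle ip k0 cU1' (cyclic_stable cU2) sB.1 pairing_invariant Uu u0 rad.
by move/(_ _ (cyclic_gen cU2)); rewrite pairing_gen ?stable_act // => ->.
Qed.

(** For w = q(T)v2 in the right radical, the conjugate reverse of q kills v1, so f divides it;
    reversing again, the dual of f divides q, and w = 0. *)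
Lemma pairing_nondegr w : w \in U2 -> (forall u, u \in U1 -> B u w = 0) -> w = 0.
Proof.
case: cU2 => _ mU2 aU2 /mU2[q ->] rad; apply/aU2.
have sU1 := cyclic_stable cU1; have Uv1 := cyclic_gen cU1.
have cU1' := cU1; rewrite fE in cU1'.
have y0 : act T (crev c (size q) q) v1 = 0.
  apply/eqP; apply: contraNT lam0 => y0.
  have [g <-] := cyclic_socle ip k0 cU1' (stable_act _ sU1 Uv1) y0.
  (* The power T^(size q) in the test vector turns the adjoint of q into its conjugate reverse. *)
  have := rad (act T ('X^(size q) * g) v1) (stable_act _ sU1 Uv1).
  rewrite BE ?stable_act // actM actXn.
  have -> n x : act_adj c T q (iter n T x) = iter n T (act_adj c T q x).
    by elim: n => //= n <-; rewrite act_adj_T.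
  by rewrite iter_act_adj // actCA => ->.
case: cU1 => nf _ aU1; have [h hE] : exists h : {poly F}, crev c (size q) q = h * f.
  by apply/dvdpP/aU1.
have qE := crevK cK (leqnSn (size q)); rewrite hE in qE.
have [h0|h0] := eqVneq h 0.
  by rewrite -qE h0 mul0r crev0 dvdp0.
have := size_crev c (size q) q; rewrite hE size_mul // => sz.
have sf : (0 < size f)%N by rewrite size_poly_gt0.
have sh : (0 < size h)%N by rewrite size_poly_gt0.
(* The nominal degree is split into deg f and the remainder, so that [crevM] yields the factor
   [crev c (size f).-1 f], a scalar multiple of the dual of f. *)
have [nE szh] : (size q = (size q - (size f).-1) + (size f).-1)%N
    /\ (size h <= (size q - (size f).-1).+1)%N.
  by move: sz sf sh; move: (size h) (size f) (size q); lia.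
rewrite -qE nE crevM ?leqSpred //.
by rewrite dvdp_mull // dualE // dvdpZl ?conj_neq0.
Qed.

End Pairing.

Lemma has_form_self_dual U f : (exists a, c a <> a) -> primary_cyclic T U f ->
  f.[0] != 0 -> dual c f = f -> has_form_on U.
Proof.
move=> [a ca] [v [p [k [mp ip k0 fE cU]]]] f0 df.
have sU := cyclic_stable cU; have Uv := cyclic_gen cU.
set s0 := act T (p ^+ k.-1) v; have Us0 : s0 \in U by apply: stable_act.
have s00 : s0 != 0 by apply: (cyclic_socle_neq0 ip k0); rewrite -fE; exact: cU.
have [lam lam0] := exists_functional s00.
have cU' : cyclic_on T U v (dual c f) by rewrite df.
have [B sB BE] := exists_pairing lam cU f0 cU'.
have invB := pairing_invariant cU cU' BE.
(* The displayed value is the hermitian form for [b] at (s0, v). Were it zero for both b = 1 and b =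
   a, then (a - c a) lam(s0) would vanish. *)
suff H b : b * lam s0 + c (b * B v s0) != 0 -> has_form_on U.
  have [e1|/H//] := eqVneq (1 * lam s0 + c (1 * B v s0)) 0.
  apply: (H a); apply: contra_not_neq ca => ea; apply/eqP; rewrite -subr_eq0.
  suff : (a - c a) * lam s0 == 0.
    by rewrite mulf_eq0 (negPf lam0) orbF !subr_eq0 eq_sym.
  rewrite !mul1r in e1; rewrite -ea rmorphM; apply/eqP.
  have -> : c (B v s0) = - lam s0 by apply/eqP; rewrite -addr_eq0 addrC e1.
  by rewrite mulrN mulrBl.
move=> nz; pose sigma u w := b * B u w + c (b * B w u).
have hs : hermitian_map c sigma by apply: sesqui_hermitian.
have invs : {in U &, forall u w, sigma (T u) (T w) = sigma u w}.
  by move=> u w Uu Uw; rewrite /sigma !invB.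
exists sigma; split=> // u Uu rad; apply/eqP; apply: contraNT nz => u0.
have cUp := cU; rewrite fE in cUp.
have := radical_socle ip k0 cUp sU hs.1 invs Uu u0 rad Uv.
by rewrite /sigma (pairing_gen BE) // => ->.
Qed.

Lemma has_form_hyperbolic U1 U2 f : primary_cyclic T U1 f ->
  primary_cyclic T U2 (dual c f) -> f.[0] != 0 -> (U1 :&: U2)%VS = 0%VS ->
  has_form_on (U1 + U2).
Proof.
move=> [v1 [p [k [mp ip k0 fE cU1]]]] [v2 [_ [_ [_ _ _ _ cU2]]]] f0 cap0.
have st1 := cyclic_stable cU1; have st2 := cyclic_stable cU2.
have Uv := cyclic_gen cU1.
have s00 : act T (p ^+ k.-1) v1 != 0.
  by apply: (cyclic_socle_neq0 ip k0); rewrite -fE; exact: cU1.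
have [lam lam0] := exists_functional s00.
have [B sB BE] := exists_pairing lam cU1 f0 cU2.
have invB := pairing_invariant cU1 cU2 BE.
(* Only the U1-component of the first argument meets the U2-component of the second, which makes U1
   and U2 isotropic for [sigma]. *)
pose B' u w := B (daddv_pi U1 U2 u) (daddv_pi U2 U1 w).
have sB' : sesquilinear_map B'.
  by split=> a u v w; rewrite /B' linearP ?sB.1 ?sB.2.
have B'E u1 u2 w1 w2 : u1 \in U1 -> u2 \in U2 -> w1 \in U1 -> w2 \in U2 ->
    B' (u1 + u2) (w1 + w2) = B u1 w2.
  by move=> *; rewrite /B' (daddv_pi_sum cap0) // (daddv_pi_sumr cap0).
pose sigma u w := 1 * B' u w + c (1 * B' w u).
exists sigma; split; first exact: sesqui_hermitian.
  move=> _ _ /memv_addP[u1 Uu1 [u2 Uu2 ->]] /memv_addP[w1 Uw1 [w2 Uw2 ->]].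
  have st (W : {vspace V}) x : stable T W -> x \in W -> T x \in W.
    by move=> sW Wx; rewrite -(actX T x) stable_act.
  by rewrite /sigma ![T (_ + _)]linearD /= !B'E ?st // !invB.
move=> _ /memv_addP[u1 Uu1 [u2 Uu2 ->]] rad.
have radE w1 w2 : w1 \in U1 -> w2 \in U2 -> B u1 w2 + c (B w1 u2) = 0.
  by move=> Uw1 Uw2; have := rad _ (memv_add Uw1 Uw2); rewrite /sigma !B'E // !mul1r.
have -> : u1 = 0.
  apply: (pairing_nondegl cU1 cU2 sB BE ip k0 fE lam0) => // w Uw.
  have := radE 0 w (mem0v _) Uw; rewrite (sesqui_0l _ sB) rmorph0 addr0 //.
have -> : u2 = 0.
  apply: (pairing_nondegr cU1 f0 cU2 BE ip k0 fE lam0) => // w Uw.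
  have := radE w 0 Uw (mem0v _); rewrite (sesqui_0r _ sB) add0r => /eqP.
  by rewrite fmorph_eq0 => /eqP.
by rewrite addr0.
Qed.

(** The removed pair x, d x is permuted by d, so the counts of y and d y drop by the same amount. *)
Lemma count_rem_pair (D : eqType) (d : D -> D) (x y : D) (s : seq D) :
  d x \in s -> d (d x) = x -> d (d y) = y ->
  count_mem (d y) (x :: s) = count_mem y (x :: s) ->
  count_mem (d y) (rem (d x) s) = count_mem y (rem (d x) s).
Proof.
move=> xs dx dy /=; rewrite !(permP (perm_to_rem xs)) /=.
have -> : (x == d y) = (d x == y) by apply/eqP/eqP => [->|<-].
have -> : (d x == d y) = (x == y).
  by apply/eqP/eqP => [/(congr1 d)|->//]; rewrite dx dy.
lia.
Qed.

(** Induction on the length of the list: a head equal to its dual is split off alone, any other head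
    together with a piece for its dual. The condition on counts survives both removals. *)
Lemma has_form_decomposed U s : (exists a, c a <> a) ->
  decomposed (primary_cyclic T) U s ->
  (forall f, f \in s -> dual c f = f \/ count_mem (dual c f) s = count_mem f s) ->
  has_form_on U.
Proof.
move=> cnt; have [n] := ubnP (size s); elim: n s U => // n IH [|f s] U ltsn.
  by move=> /= -> _; apply: has_form_on0.
have prim g t W : g \in t -> decomposed (primary_cyclic T) W t ->
    g \is monic /\ g.[0] != 0.
  move=> gt dW.
  have [W1 [_ [[v [p [k [mp ip k0 gE cW]]]] _ _ _]]] := decomposed_rem gt dW.
  split; first by rewrite gE monic_exp.
  by rewrite (cyclic_root0 kerT cW) // gE size_irr_pow_gt1.
move=> dU cs; have [mf f0] := prim f _ _ (mem_head f s) dU.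
have dK g : g \in f :: s -> dual c (dual c g) = g.
  by move=> gs; have [mg g0] := prim g _ _ gs dU; rewrite dualK.
have [U1 [W [P1 dW cap0 eU]]] := dU.
have st1 : stable T U1 by case: P1 => v [p [k [_ _ _ _ /cyclic_stable]]].
have stW := decomposed_stable dW.
have [df|ndf] := eqVneq (dual c f) f.
  rewrite -eU; apply: has_form_onD => //; first exact: has_form_self_dual P1 f0 df.
  apply: (IH s) => // g gs; have gfs : g \in f :: s by rewrite inE gs orbT.
  have [->|nfg] := eqVneq g f; first by left.
  have [|] := cs g gfs; first by left.
  rewrite /= [f == g]eq_sym (negPf nfg); have [e|_] := eqVneq f (dual c g); last by right.
  by case/eqP: nfg; rewrite -(dK g gfs) -e.
(* The head counts at least once, so its dual, being different from it, must occur in the tail. *)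
have dfs : dual c f \in s.
  have [e|] := cs f (mem_head f s); first by rewrite e eqxx in ndf.
  rewrite /= eqxx eq_sym (negPf ndf) add0n => e.
  by rewrite -has_pred1 has_count e.
have [U2 [W' [P2 dW' cap1 eW]]] := decomposed_rem dfs dW.
have st2 : stable T U2 by case: P2 => v [q [k [_ _ _ _ /cyclic_stable]]].
rewrite -eW in cap0; have {cap0} : ((U2 + W') :&: U1)%VS = 0%VS by rewrite capvC.
rewrite addvC => cap0; have cap1' : (W' :&: U2)%VS = 0%VS by rewrite capvC.
have [cap2 cap3] := capv0_assoc cap1' cap0.
have -> : U = ((U1 + U2) + W')%VS by rewrite -eU -eW addvA.
apply: has_form_onD.
- exact: stableD.
- exact: decomposed_stable dW'.
- by rewrite capvC addvC.
- by apply: has_form_hyperbolic P1 P2 f0 _; rewrite capvC.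
apply: (IH (rem (dual c f) s)) => //.
  by rewrite size_rem //; move: ltsn => /=; case: (size s) => // m; lia.
move=> g gs; have gs' := mem_rem gs; have gfs : g \in f :: s by rewrite inE gs' orbT.
have [|e] := cs g gfs; first by left.
by right; apply: count_rem_pair; rewrite ?dK ?mem_head.
Qed.

End FormConstruction.

(** * Both directions of the equivalence *)

Theorem theorem2p1 (F : fieldType) (c : {rmorphism F -> F})
    (cK : involutive c) (c_nontrivial : exists a : F, c a <> a)
    (V : vectType F) (dimV : (2 <= \dim {:V})%N)
    (T : 'End(V)) (T_inv : bijective T) :
  (exists sigma : {hermitian_sym V for c},
      T_invariant T sigma /\ nondegenerate sigma)
  <->
  (forall f : {poly F}, elementary_divisor T f ->
      self_dual c f \/
      (elementary_divisor T (dual c f) /\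
       forall m : nat,
         has_multiplicity T f m <-> has_multiplicity T (dual c f) m)).
Proof.
have kerT : lker T == 0%VS by apply/lker0P/bij_inj.
split=> [[sigma [inv nd]] f [s ds fs]|H].
  have herm : hermitian_map c sigma.
    split=> [a u v w|u w]; first by rewrite linearPl.
    by rewrite hermC expr0 mul1r.
  have nondeg u : (forall w, sigma u w = 0) -> u = 0.
    move=> rad; apply/eqP; rewrite -memv0 -(eqP nd).
    by apply/mem_orthovP => w _.
  have [p [k [mp ip fE]]] := elementary_divisors_primary ds fs.
  have p0 : p.[0] != 0.
    by apply: (elementary_divisors_root0 kerT ds (k := k)); rewrite -fE.
  (* The second alternative holds for every elementary divisor, self-dual or not. *)
  right; have cE t : elementary_divisors T t -> count_mem (dual c f) t = count_mem f t.
    by move=> dt; rewrite fE (count_dual cK kerT herm inv nondeg).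
  split.
    by exists s => //; rewrite -has_pred1 has_count cE // -has_count has_pred1.
  by move=> m; split=> -[t dt <-]; exists t; rewrite ?cE.
have [s ds] := exists_elementary_divisors T.
have [sigma [herm inv nondeg]] : has_form_on c T fullv.
  have /elementary_divisorsP ds' := ds.
  apply: (has_form_decomposed cK kerT c_nontrivial (s := s)).
    by apply: decomposed_sub ds' => W f [].
  move=> f fs; have [sd|[_ Hm]] := H f (ex_intro2 _ _ s ds fs).
    by left; apply: dual_fixed.
  (* The multiplicity of the dual is witnessed by a possibly different list [t];
     [multiplicity_unique] transfers it to [s]. *)
  right; have [t dt <-] := (Hm (count_mem f s)).1 (ex_intro2 _ _ s ds erefl).
  have [p [k [mp ip fE]]] := elementary_divisors_primary ds fs.
  have p0 : p.[0] != 0.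
    by apply: (elementary_divisors_root0 kerT ds (k := k)); rewrite -fE.
  rewrite fE dual_exp //.
  exact: multiplicity_unique ds dt (dual_monic _ p0) (dual_irreducible cK mp p0 ip).
have addl w : zmod_morphism (sigma^~ w).
  by move=> u v; rewrite addrC -scaleN1r herm.1 mulN1r addrC.
have addr u : zmod_morphism (sigma u).
  by move=> v w; rewrite (herm_Dr herm) -scaleN1r (herm_Zr herm) rmorphN1 mulN1r.
have scalel w : scalable_for *%R (sigma^~ w) by move=> a u; rewrite (herm_Zl herm).
have scaler u : scalable_for (c \; *%R) (sigma u).
  by move=> a w; rewrite (herm_Zr herm).
(* The sign exponent [false] selects hermitian rather than skew-hermitian symmetry. *)
have hs u w : sigma u w = (-1) ^+ false * c (sigma w u) by rewrite mul1r herm.2.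
pose sigmaH : {hermitian_sym V for c} := HB.pack sigma
  (isBilinear.Build F V V F *%R (c \; *%R) sigma addl addr scalel scaler)
  (isHermitianSesquilinear.Build F V false c sigma hs).
exists sigmaH; split=> [u w|]; first by apply: inv; apply: memvf.
rewrite /nondegenerate -subv0; apply/subvP => u /mem_orthovP rad.
rewrite memv0; apply/eqP; apply: nondeg => [|w _]; first exact: memvf.
exact: rad (memvf w).
Qed.
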